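(* Let $n\ge 2$. There exists a compact set $E\subset\mathbb{R}^n$ of Hausdorff dimension $n/4$ such that $E$ does not contain three distinct points forming an angle $\alpha$ for which $\cos^2\alpha$ is rational. Moreover, $E$ does not contain four distinct points $x,y,z,v$ such that the directions $x-y$ and $z-v$ form an angle $\alpha$ for which $\cos^2\alpha$ is rational.
   Context: Three distinct points $x,y,z\in\mathbb{R}^n$ form the angle $\alpha$ if, for some labelling of them, the angle $\angle yxz\in[0,\pi]$ at the vertex $x$ between the vectors $y-x$ and $z-x$ equals $\alpha$. For $x\ne y$ and $z\ne v$, the directions $x-y$ and $z-v$ form the angle $\alpha\in[0,\pi]$ given by $\cos\alpha=\frac{\langle x-y,z-v\rangle}{|x-y||z-v|}$. *)

(* Defs.v *)
From mathcomp Require Import all_boot all_order all_algebra.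
From mathcomp Require Import all_classical all_reals all_analysis.

Set Implicit Arguments.
Unset Strict Implicit.
Unset Printing Implicit Defensive.
Import Order.TTheory GRing.Theory Num.Theory.
Import numFieldNormedType.Exports.

Local Open Scope classical_set_scope.
Local Open Scope ring_scope.

Definition dotv (R : realType) (n : nat) (u v : 'rV[R]_n) : R :=
  \sum_(i < n) u ord0 i * v ord0 i.

(* The library norm on 'rV[R]_n is the sup norm; it induces the same topology
   as the Euclidean norm below, but not the same lengths and diameters. *)
Definition enorm (R : realType) (n : nat) (u : 'rV[R]_n) : R :=
  Num.sqrt (dotv u u).

(* diam set0 = -oo *)
Definition diam (R : realType) (n : nat) (A : set 'rV[R]_n) : \bar R :=
  ereal_sup [set (enorm (x - y))%:E | x in A & y in A].

(* The empty set is singled out so that it contributes 0 to every sum,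
   including for s = 0, where x `^ 0 = 1 for all x. *)
Definition diam_pow (R : realType) (n : nat) (s : R) (A : set 'rV[R]_n) :
    \bar R :=
  if A == set0 then 0%E else (diam A `^ s)%E.

Definition hausdorff_premeasure (R : realType) (n : nat) (s delta : R)
    (A : set 'rV[R]_n) : \bar R :=
  ereal_inf [set (\sum_(0 <= i <oo) diam_pow s (U i))%E | U in
    [set U : (set 'rV[R]_n)^nat |
      A `<=` \bigcup_i U i /\ forall i, (diam (U i) <= delta%:E)%E]].

Definition hausdorff_measure (R : realType) (n : nat) (s : R)
    (A : set 'rV[R]_n) : \bar R :=
  ereal_sup [set hausdorff_premeasure s delta A | delta in [set d : R | 0 < d]].

Definition hausdorff_dim (R : realType) (n : nat) (A : set 'rV[R]_n) : \bar R :=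
  ereal_inf [set s%:E | s in
    [set s : R | 0 <= s /\ hausdorff_measure s A = 0%E]].

(* Only meaningful for nonzero u and v. *)
Definition is_angle (R : realType) (n : nat) (u v : 'rV[R]_n) (alpha : R) :
    Prop :=
  0 <= alpha <= pi /\ cos alpha = dotv u v / (enorm u * enorm v).

(* The angle at each vertex is symmetric in the other two points, so the six
   labellings reduce to the choice of the vertex. *)
Definition points_form_angle (R : realType) (n : nat) (x y z : 'rV[R]_n)
    (alpha : R) : Prop :=
  [\/ is_angle (y - x) (z - x) alpha,
      is_angle (x - y) (z - y) alpha
    | is_angle (x - z) (y - z) alpha].

Definition is_rational (R : realType) (a : R) : Prop :=
  exists q : rat, a = ratr q.

(* Main.v *)
Require Import Defs.
From mathcomp Require Import all_boot all_order all_algebra.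
From mathcomp Require Import all_classical all_reals all_analysis.
From mathcomp Require Import finmap zify ring lra.
Import Order.TTheory GRing.Theory Num.Theory.
Import numFieldNormedType.Exports.
Local Open Scope classical_set_scope.
Local Open Scope ring_scope.

(* Level [k] of a Cantor set consists of boxes of radius
   [r_k = 1 / ((k + 1) N_k ^ 4)] centred at points of the lattice [Z^n / N_k].
   With [N_k] growing fast enough, about [N_k ^ n] boxes of radius close to
   [N_k ^ -4] give dimension [n / 4]. The parities of the numerators of the
   centres can be prescribed independently for every box.

   If [cos alpha ^ 2 = p / q], then
   [q <x - y, z - v> ^ 2 - p |x - y| ^ 2 |z - v| ^ 2 = 0], a form of degree 4
   with integer coefficients. At the centres of four boxes of level [k] it is an
   integer multiple of [N_k ^ -4], and for a suitable choice of parities near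
   [x] and [z] an odd one, hence at least [N_k ^ -4] in absolute value. Passing
   from the centres to [x], [y], [z], [v] changes it by only [O (r_k)], which is
   smaller once [k] is large. Every choice of parities recurs at infinitely
   many levels. Three points with vertex [y] are the case [v = y]. *)

(** * Scales and the tree of nodes *)

(** The step is [2 * branch k * invrad k] written out, as in [scaleS]. Hence [2 * branch k] steps of
    the lattice of level [k.+1] span exactly one radius of level [k]. *)
Fixpoint scale (k : nat) : nat :=
  if k is j.+1 then
    let R := (j.+1 * scale j ^ 4)%N in
    (2 * ((2 * j.+2 * (2 * R) ^ 4) ^ j.+1) * R)%N
  else 1.

(** The factor [k.+1] makes the measure vanish at the exponent [n / 4] itself, and makes the
    perturbation error tend to 0 relative to [scale k ^ -4]. *)
Definition invrad (k : nat) : nat := (k.+1 * scale k ^ 4)%N.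

(* Since [2 * invrad k.+1 = growth k ^ (4 * k.+1).+1] and
   [branch k = growth k ^ k.+1], the power [invrad k `^ s] is eventually
   dominated by [branch (k - 1) ^ n] for every [s < n / 4]. *)
Definition growth (k : nat) : nat := (2 * k.+2 * (2 * invrad k) ^ 4)%N.

Definition branch (k : nat) : nat := (growth k ^ k.+1)%N.

(** Half of [scale k.+1 / scale k]: the digit 0 then gives a child whose unperturbed point is the
    centre of its parent. *)
Definition stride (k : nat) : nat := (branch k * k.+1 * scale k ^ 3)%N.

Definition width (k : nat) : nat := \prod_(j < k) branch j.

Lemma scaleS k : scale k.+1 = (2 * branch k * invrad k)%N.
Proof. by []. Qed.

Arguments scale : simpl never.

Lemma scale_gt0 k : (0 < scale k)%N.
Proof.
elim: k => [//|k IH]; rewrite scaleS /branch /growth /invrad.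
by rewrite !(muln_gt0, expn_gt0) IH.
Qed.

Lemma invrad_gt0 k : (0 < invrad k)%N.
Proof. by rewrite /invrad muln_gt0 expn_gt0 scale_gt0. Qed.

Lemma growth_gt0 k : (0 < growth k)%N.
Proof. by rewrite /growth !(muln_gt0, expn_gt0) scale_gt0. Qed.

Lemma branch_gt0 k : (0 < branch k)%N.
Proof. by rewrite /branch expn_gt0 growth_gt0. Qed.

Lemma width_gt0 k : (0 < width k)%N.
Proof. by rewrite prodn_gt0 // => i; exact: branch_gt0. Qed.

Lemma widthS k : width k.+1 = (width k * branch k)%N.
Proof. by rewrite /width big_ord_recr. Qed.

Lemma scaleS_stride k : scale k.+1 = (2 * stride k * scale k)%N.
Proof. by rewrite scaleS /stride /invrad; lia. Qed.

Lemma leq_branch_stride k : (branch k <= stride k)%N.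
Proof.
by rewrite /stride -mulnA leq_pmulr // muln_gt0 expn_gt0 scale_gt0.
Qed.

Lemma stride_gt0 k : (0 < stride k)%N.
Proof. exact: leq_trans (branch_gt0 k) (leq_branch_stride k). Qed.

Lemma leq_scale_invrad k : (scale k <= invrad k)%N.
Proof.
by rewrite /invrad expnS mulnCA leq_pmulr // muln_gt0 expn_gt0 scale_gt0.
Qed.

Lemma leq_width_scale k : (width k <= scale k)%N.
Proof.
elim: k => [|k IH]; first by rewrite /width big_ord0.
rewrite widthS scaleS (leq_trans (leq_mul IH (leqnn _))) //.
rewrite (leq_trans (leq_mul (leq_scale_invrad k) (leqnn _))) //; lia.
Qed.

Lemma double_invradS k :
  (2 * invrad k.+1 = growth k ^ (4 * k.+1).+1)%N.
Proof.
rewrite {1}/invrad scaleS [RHS]expnS [(4 * _)%N]mulnC expnM -/(branch k).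
by rewrite /growth 2![in LHS]expnMn [in RHS]expnMn; lia.
Qed.

Lemma ltn_scale k : (k < scale k)%N.
Proof.
elim: k => [//|k IH]; rewrite scaleS.
have := leq_scale_invrad k; have := branch_gt0 k; nia.
Qed.

Lemma leq_scale j k : (j <= k)%N -> (scale j <= scale k)%N.
Proof.
elim: k => [|k IH]; first by rewrite leqn0 => /eqP ->.
rewrite leq_eqVlt => /orP[/eqP -> //|/IH h]; apply: leq_trans h _.
by rewrite scaleS_stride leq_pmull // muln_gt0 stride_gt0.
Qed.

(* [rho k m] perturbs the level-[k] node [m] inside its lattice cell: the
   associated point is [anchor k m / scale k], whose numerators have the
   prescribed parities [rho k m]. *)
Section Tree.
Context {n : nat} (rho : nat -> {ffun 'I_n -> nat} -> 'I_n -> bool).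

Definition anchor (k : nat) (m : {ffun 'I_n -> nat}) (i : 'I_n) : nat :=
  (2 * m i + rho k m i)%N.

Definition child (k : nat) (m : {ffun 'I_n -> nat})
    (d : {ffun 'I_n -> 'I_(branch k)}) : {ffun 'I_n -> nat} :=
  [ffun i => (anchor k m i * stride k + d i)%N].

Fixpoint nodes (k : nat) : seq {ffun 'I_n -> nat} :=
  if k is j.+1 then
    [seq child j m d | m <- nodes j, d <- enum {ffun 'I_n -> 'I_(branch j)}]
  else [:: [ffun => 0%N]].

Lemma size_nodes k : size (nodes k) = (width k ^ n)%N.
Proof.
elim: k => [|k IH] /=; first by rewrite /width big_ord0 exp1n.
by rewrite size_allpairs IH -cardE card_ffun !card_ord widthS expnMn.
Qed.

(** Every digit is below [branch k <= stride k], so division by [stride k] recovers the digit and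
    the anchor; halving the anchor recovers the node whatever the parities are. *)
Lemma child_inj k m m' d d' :
  child k m d = child k m' d' -> m = m' /\ d = d'.
Proof.
move=> /ffunP E.
have lt i (e : {ffun 'I_n -> 'I_(branch k)}) : (e i < stride k)%N.
  exact: leq_trans (ltn_ord _) (leq_branch_stride k).
have Ea i : anchor k m i = anchor k m' i /\ (d i = d' i :> nat).
  have := E i; rewrite !ffunE => {}E.
  have Eq := congr1 (divn^~ (stride k)) E; have Em := congr1 (modn^~ (stride k)) E.
  move: Eq Em; rewrite /= !divnMDl ?stride_gt0 // !modnMDl.
  by rewrite !divn_small ?modn_small ?lt // !addn0.
split; apply/ffunP => i; last by apply: val_inj; case: (Ea i).
have [] := Ea i; rewrite /anchor => + _.
by case: (rho k m i); case: (rho k m' i) => /=; lia.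
Qed.

Lemma uniq_nodes k : uniq (nodes k).
Proof.
elim: k => [//|k IH] /=; apply: allpairs_uniq => //; first exact: enum_uniq.
by move=> [m d] [m' d'] _ _ /= /child_inj [-> ->].
Qed.

Lemma nodesS k m' :
  reflect (exists m d, m \in nodes k /\ m' = child k m d) (m' \in nodes k.+1).
Proof.
apply: (iffP allpairsP) => [[[m d] /= [mk _ ->]]|[m [d [mk ->]]]].
  by exists m, d.
by exists (m, d); split=> //=; rewrite mem_enum.
Qed.

Lemma count_nodesS k (a b : pred {ffun 'I_n -> nat}) :
  (forall m d, b (child k m d) -> a m) ->
  (count b (nodes k.+1) <= branch k ^ n * count a (nodes k))%N.
Proof.
move=> ba /=; elim: (nodes k) => [|m s IH]; first by rewrite muln0.
rewrite allpairs_cons count_cat /= mulnDr leq_add //.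
case am: (a m); rewrite ?muln1 ?muln0.
  apply: leq_trans (count_size _ _) _.
  by rewrite size_map -cardE card_ffun !card_ord.
rewrite leqn0 -leqn0 leqNgt -has_count; apply/hasPn => m'.
by case/mapP => d _ ->; apply: contraFN am; exact: ba.
Qed.

(** The proportion of nodes with a property inherited by parents cannot increase with the level;
    denominators are cleared. For [touches V] this proportion stands in for the uniform mass of
    [V]. *)
Lemma count_nodes_ratio k K (a : nat -> pred {ffun 'I_n -> nat}) :
  (forall j m d, a j.+1 (child j m d) -> a j m) -> (k <= K)%N ->
  (width k ^ n * count (a K) (nodes K) <=
   width K ^ n * count (a k) (nodes k))%N.
Proof.
move=> aP; elim: K => [|K IH]; first by rewrite leqn0 => /eqP ->.
rewrite leq_eqVlt => /orP[/eqP <- //|/IH {}IH].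
have h := count_nodesS K (a K) (a K.+1) (aP K).
rewrite (leq_trans (leq_mul (leqnn _) h)) //.
by rewrite mulnCA widthS expnMn -mulnA (mulnCA (width K ^ n)%N) leq_mul2l IH orbT.
Qed.

End Tree.

Lemma size_uniq_bounded n (s : seq {ffun 'I_n -> nat}) (b : nat) :
  uniq s ->
  (forall m m' i, m \in s -> m' \in s -> (m i <= m' i + b)%N) ->
  (size s <= (2 * b).+1 ^ n)%N.
Proof.
case: s => [//|m0 s]; set t := m0 :: s => us sb.
(* All coordinates lie within [b] of those of [m0], so the shift by [b - m0 i] puts them in
   [[0, 2 * b]]. *)
pose f (m : {ffun 'I_n -> nat}) : {ffun 'I_n -> 'I_(2 * b).+1} :=
  [ffun i => inord (m i + b - m0 i)].
have m0t : m0 \in t by rewrite mem_head.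
have key (u v w : nat) : (w <= u + b)%N -> (w <= v + b)%N -> (u <= w + b)%N ->
    (v <= w + b)%N ->
    inord (u + b - w) = inord (v + b - w) :> 'I_(2 * b).+1 -> u = v.
  by move=> ? ? ? ? /(congr1 val); rewrite /= !inordK; lia.
rewrite -(size_map f) -(card_uniqP _); last first.
  rewrite map_inj_in_uniq // => m m' mt m't /ffunP E; apply/ffunP => i.
  by have := E i; rewrite !ffunE; apply: key; exact: sb.
by rewrite (leq_trans (max_card _)) // card_ffun !card_ord.
Qed.

(** * The Cantor set *)

Section CantorSet.
Context {R : realType} {n : nat}.
Variable rho : nat -> {ffun 'I_n -> nat} -> 'I_n -> bool.

Local Notation nodes := (nodes rho).
Local Notation child := (child rho).
Local Notation anchor := (anchor rho).

Definition node_coord (k : nat) (m : {ffun 'I_n -> nat}) (i : 'I_n) : R :=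
  (anchor k m i)%:R / (scale k)%:R.

Definition box (k : nat) (m : {ffun 'I_n -> nat}) : set 'rV[R]_n :=
  [set x | forall i, `|x ord0 i - node_coord k m i| <= (invrad k)%:R^-1].

Definition cantor_set : set 'rV[R]_n :=
  \bigcap_k \bigcup_(m in [set` nodes k]) box k m.

Lemma scale_pos k : 0 < (scale k)%:R :> R.
Proof. by rewrite ltr0n scale_gt0. Qed.

Lemma invrad_pos k : 0 < (invrad k)%:R :> R.
Proof. by rewrite ltr0n invrad_gt0. Qed.

Lemma node_coord_child k m d i :
  node_coord k.+1 (child k m d) i = node_coord k m i +
    (2 * d i + rho k.+1 (child k m d) i)%:R / (scale k.+1)%:R.
Proof.
rewrite /node_coord {1}/anchor ffunE scaleS_stride.
have := stride_gt0 k; have := scale_gt0 k.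
move: (rho k.+1 _ _) (scale k) (stride k) (anchor k m i) => e N L a N0 L0.
by rewrite !(natrD, natrM); field; rewrite !pnatr_eq0 -!lt0n N0 L0.
Qed.

Lemma box_child k m d : box k.+1 (child k m d) `<=` box k m.
Proof.
move=> x xb i; have := xb i; rewrite node_coord_child.
set t := _%:R / _; set c := node_coord k m i; set e' := _^-1; set e := _^-1 => h.
have t0 : 0 <= t by rewrite divr_ge0.
suff : t + e' <= e by move: h; rewrite !ler_norml => /andP[]; lra.
(* The last [1] pays for the radius of the child, at most [1 / scale k.+1]; the total
   [2 * branch k / scale k.+1] is the radius of the parent. *)
have d1 : (2 * d i + rho k.+1 (child k m d) i + 1 <= 2 * branch k)%N.
  by have := ltn_ord (d i); case: (rho _ _ _) => /=; lia.
have e'le : e' <= (scale k.+1)%:R^-1.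
  by rewrite lef_pV2 ?posrE ?scale_pos ?invrad_pos // ler_nat leq_scale_invrad.
apply: (@le_trans _ _ (t + (scale k.+1)%:R^-1)); first by rewrite lerD2l.
rewrite /t -[X in _ + X]mul1r -mulrDl ler_pdivrMr ?scale_pos //.
rewrite scaleS natrM /e mulrC mulfK ?gt_eqF ?invrad_pos //.
by rewrite natr1 ler_nat -addn1.
Qed.

Lemma box_node_coord k m : box k m (\row_i node_coord k m i).
Proof. by move=> i; rewrite mxE subrr normr0 invr_ge0. Qed.

Lemma box_ancestor k j m : m \in nodes (k + j)%N ->
  exists2 m', m' \in nodes k & box (k + j)%N m `<=` box k m'.
Proof.
elim: j m => [|j IH] m; first by rewrite addn0 => mk; exists m.
rewrite addnS => /nodesS[m1 [d [m1k ->]]].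
have [m' m'k sub] := IH _ m1k; exists m' => //.
exact: subset_trans (box_child _ _ _) sub.
Qed.

(* The point is the limit of the nondecreasing centers along the descendants
   with all digits zero. *)
Lemma box_cantor_set k m : m \in nodes k -> cantor_set `&` box k m !=set0.
Proof.
move=> mk; pose d0 j : {ffun 'I_n -> 'I_(branch j)} :=
  [ffun => Ordinal (branch_gt0 j)].
pose p := fix p j := if j is l.+1 then child (k + l)%N (p l) (d0 _) else m.
pose q j := p j : {ffun 'I_n -> nat}.
pose c i j := node_coord (k + j)%N (q j) i.
have qS j : q j.+1 = child (k + j)%N (q j) (d0 (k + j)%N) by [].
have qn j : q j \in nodes (k + j)%N.
  elim: j => [|j IH]; first by rewrite addn0.
  by rewrite qS addnS; apply/nodesS; exists (q j), (d0 (k + j)%N).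
have qsub j l : box (k + (j + l))%N (q (j + l)%N) `<=` box (k + j)%N (q j).
  elim: l => [|l IH]; first by rewrite !addn0.
  by apply: subset_trans IH; rewrite !addnS qS; exact: box_child.
have cS i j : c i j <= c i j.+1.
  by rewrite /c addnS qS node_coord_child lerDl divr_ge0.
have cmono i j l : (j <= l)%N -> c i j <= c i l.
  move=> /subnK <-; elim: (l - j)%N => [//|e IH].
  by rewrite addSn; exact: le_trans IH (cS _ _).
have cub i j l : c i l <= c i j + (invrad (k + j)%N)%:R^-1.
  case: (leqP j l) => jl; last first.
    by rewrite (le_trans (cmono i _ _ (ltnW jl))) // lerDl invr_ge0.
  have := qsub j (l - j)%N _ (box_node_coord _ _) i.
  by rewrite mxE subnKC // -/(c i l) -/(c i j) ler_norml; lra.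
pose x : 'rV[R]_n := \row_i sup (range (c i)).
have xb j : box (k + j)%N (q j) x.
  move=> i; rewrite mxE -/(c i j) ler_norml.
  have h1 : c i j <= sup (range (c i)).
    apply: ub_le_sup; last by exists j.
    by exists (c i 0%N + (invrad (k + 0)%N)%:R^-1) => _ [l _ <-].
  have h2 : sup (range (c i)) <= c i j + (invrad (k + j)%N)%:R^-1.
    by apply: ge_sup => [|_ [l _ <-]]; [exists (c i j), j|].
  have : 0 <= (invrad (k + j))%:R^-1 :> R by rewrite invr_ge0.
  by move: h1 h2; set e := _^-1; lra.
exists x; split; last by have := xb 0%N; rewrite addn0.
move=> l _; case: (leqP k l) => kl.
  by exists (q (l - k)%N); have := xb (l - k)%N; have := qn (l - k)%N;
    rewrite subnKC.
have [m' m'l sub] : exists2 m', m' \in nodes l & box k m `<=` box l m'.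
  by rewrite -(subnKC (ltnW kl)); apply: box_ancestor; rewrite subnKC // ltnW.
by exists m' => //; apply: sub; have := xb 0%N; rewrite addn0.
Qed.

Lemma compact_box k m : compact (box k m).
Proof.
pose I i := `[node_coord k m i - (invrad k)%:R^-1, node_coord k m i + (invrad k)%:R^-1].
rewrite (_ : box k m = [set v | forall i, [set` I i] (v ord0 i)]).
  by apply: (@rV_compact R n (fun i => [set` I i])) => i; exact: segment_compact.
apply/seteqP; split => x xb i; have := xb i.
  by rewrite /= in_itv /= ler_distl.
by rewrite /= in_itv /= ler_distl.
Qed.

Lemma compact_cantor_set : compact cantor_set.
Proof.
have clb k m : closed (box k m).
  by apply: compact_closed (compact_box k m); exact: norm_hausdorff.
apply: (@subclosed_compact _ _ (box 0 [ffun => 0%N])).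
- apply: closed_bigI => k _; rewrite bigcup_seq.
  by apply: closed_bigsetU => m _; exact: clb.
- exact: compact_box.
- by move=> x /(_ 0%N I) [m /=]; rewrite inE => /eqP ->.
Qed.

(** * Counting the boxes that meet a small set *)

Definition touches (V : set 'rV[R]_n) (k : nat) : pred {ffun 'I_n -> nat} :=
  fun m => `[< box k m `&` V !=set0 >].

Lemma touches_child V k m d : touches V k.+1 (child k m d) -> touches V k m.
Proof.
move=> /asboolP [x [xb xV]]; apply/asboolP; exists x; split => //.
exact: box_child xb.
Qed.

(** If two boxes meet [V], their numerators differ by at most [scale k * r + 2], each radius being
    at most [1 / scale k]. The third unit absorbs the difference of the parities upon halving. *)
Lemma count_touching_bounded (V : set 'rV[R]_n) k (r : R) (b : nat) :
  (forall x y i, V x -> V y -> `|x ord0 i - y ord0 i| <= r) ->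
  (scale k)%:R * r + 3 < 2 * b.+1%:R ->
  (count (touches V k) (nodes k) <= (2 * b).+1 ^ n)%N.
Proof.
move=> Vr rb; rewrite -size_filter; apply: size_uniq_bounded.
  exact: filter_uniq (uniq_nodes _ _).
move=> m m' i; rewrite !mem_filter => /andP[/asboolP[x [xb xV]] _].
move=> /andP[/asboolP[y [yb yV]] _].
have := Vr x y i xV yV; have := xb i; have := yb i.
have e'le : (invrad k)%:R^-1 <= (scale k)%:R^-1 :> R.
  by rewrite lef_pV2 ?posrE ?scale_pos ?invrad_pos // ler_nat leq_scale_invrad.
rewrite !ler_norml => h1 h2 h3.
have h : node_coord k m i - node_coord k m' i <= r + 2 * (scale k)%:R^-1.
  by move: h1 h2 h3 e'le; set e := _^-1; set f := _^-1; lra.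
have s0 := scale_pos k.
have {}h : (anchor k m i)%:R <= (anchor k m' i)%:R + ((scale k)%:R * r + 2) :> R.
  move: h; rewrite -(ler_pM2l s0) /node_coord mulrBr !mulrDr.
  rewrite !(mulrCA (scale k)%:R) !divff ?gt_eqF // !mulr1; lra.
have {}h : (anchor k m i)%:R + 1 < (anchor k m' i)%:R + 2 * b.+1%:R :> R by lra.
have key (u v w : nat) : u%:R + 1 < v%:R + 2 * w%:R :> R ->
    (u + 1 < v + 2 * w)%N.
  by rewrite -(ltr_nat R) (natrD _ u) (natrD _ v) natrM.
move/key: h {key}.
rewrite /anchor; move: (rho k m i) (rho k m' i) (m i) (m' i).
by clear => -[] [] u v /=; lia.
Qed.

Lemma count_touching_le (V : set 'rV[R]_n) k (r : R) : 0 <= r ->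
  (forall x y i, V x -> V y -> `|x ord0 i - y ord0 i| <= r) ->
  (count (touches V k) (nodes k))%:R <=
    (5 * Num.max 1 ((scale k)%:R * r)) ^+ n :> R.
Proof.
move=> r0 Vr; set u := (scale k)%:R * r.
have [Nr|Nr] := leP 1 u.
  have u0 : 0 <= 2 * u by lra.
  (* Here [b] is the integer part of [2 * u]: as [1 <= u], both [u + 3 < 2 * b.+1] and
     [2 * b + 1 <= 5 * u] hold. *)
  have := truncn_itv u0; move: (Num.truncn _) => b /andP[tl tu].
  have eb : (2 * b).+1%:R = 2 * b%:R + 1 :> R by rewrite -natrM natr1.
  apply: (@le_trans _ _ ((2 * b).+1 ^ n)%:R).
    rewrite ler_nat (@count_touching_bounded _ _ r) // -/u.
    by clearbody u; lra.
  by rewrite natrX eb lerXn2r // ?nnegrE; lra.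
rewrite mulr1 -natrX ler_nat (@count_touching_bounded _ _ r 2%N) // -/u.
by clearbody u; lra.
Qed.

(* Between the scales [1 / scale k.+1] and [1 / scale k] the bounds at the two
   levels interpolate to [r `^ s]. *)
Lemma count_touching_powR (V : set 'rV[R]_n) k K (r s : R) :
  0 <= s -> s <= n%:R -> (k < K)%N -> 0 < r ->
  (scale k)%:R * r <= 1 -> 1 < (scale k.+1)%:R * r ->
  (2 * invrad k)%:R `^ s <= (width k ^ n)%:R ->
  (forall x y i, V x -> V y -> `|x ord0 i - y ord0 i| <= r) ->
  (count (touches V K) (nodes K))%:R <= (width K ^ n)%:R * (5 ^+ n * r `^ s).
Proof.
move=> s0 sn kK r0 r1 r2 grow Vr.
set t := (2 * invrad k)%:R * r.
have t0 : 0 <= t by rewrite mulr_ge0 // ltW.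
(* By [grow], replacing [r] by [t] costs a factor of at most [width k ^ n]. *)
suff h : (width k ^ n)%:R * (count (touches V K) (nodes K))%:R <=
    (width K ^ n)%:R * (5 ^+ n * t `^ s).
  have wk : 0 < (width k ^ n)%:R :> R by rewrite ltr0n expn_gt0 width_gt0.
  rewrite -(ler_pM2l wk) (le_trans h) // [leRHS]mulrCA ler_wpM2l //.
  rewrite [leRHS]mulrCA ler_wpM2l //.
  by rewrite /t powRM ?(ltW r0) // ler_wpM2r // powR_ge0.
have sub j := @touches_child V j.
(* For [1 <= t] level [k] suffices: at most [5 ^ n] of its boxes meet [V], and [t] to the power [s]
   is at least 1. *)
have [t1|t1] := leP 1 t.
  have /(_ (ltnW kK)) h := @count_nodes_ratio _ rho k K (touches V) sub.
  rewrite -natrM (@le_trans _ _ (width K ^ n * count (touches V k) (nodes k))%:R) //.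
    by rewrite ler_nat.
  rewrite natrM ler_wpM2l // (le_trans (count_touching_le _ k r (ltW r0) Vr)) //.
  rewrite max_l // mulr1 ler_peMr ?exprn_ge0 //.
  by rewrite -(powRr0 t) ler_powR.
(* For [t < 1], level [k.+1] has at most [(5 * branch k * t) ^ n] such boxes. The refinement cancels
   [branch k ^ n], and [s <= n] bounds [t ^ n] by [t] to the power [s]. *)
have /(_ kK) h := @count_nodes_ratio _ rho k.+1 K (touches V) sub.
have b0 : 0 < (branch k ^ n)%:R :> R by rewrite ltr0n expn_gt0 branch_gt0.
rewrite -(ler_pM2l b0) -natrM -natrM mulnA -expnMn (mulnC (branch k)) -widthS.
rewrite (@le_trans _ _ (width K ^ n * count (touches V k.+1) (nodes k.+1))%:R) //.
  by rewrite ler_nat.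
rewrite natrM mulrCA ler_wpM2l //.
rewrite (le_trans (count_touching_le _ k.+1 r (ltW r0) Vr)) // max_r ?(ltW r2) //.
have -> : (scale k.+1)%:R * r = (branch k)%:R * t.
  by rewrite scaleS /t !natrM; ring.
rewrite mulrCA exprMn natrX ler_wpM2l ?exprn_ge0 // exprMn ler_wpM2l ?exprn_ge0 //.
have tp : 0 < t by rewrite mulr_gt0 // ltr0n muln_gt0 invrad_gt0.
by rewrite -powR_mulrn // ger_powR // tp ltW.
Qed.

End CantorSet.

(** * Hausdorff dimension *)

Section HausdorffMeasure.
Context {R : realType} {n : nat}.
Implicit Types (A : set 'rV[R]_n) (s : R).

Lemma dotv_ge0 (u : 'rV[R]_n) : 0 <= dotv u u.
Proof. by apply: sumr_ge0 => i _; rewrite -expr2 sqr_ge0. Qed.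

Lemma sqr_enorm (u : 'rV[R]_n) : enorm u ^+ 2 = dotv u u.
Proof. by rewrite sqr_sqrtr // dotv_ge0. Qed.

Lemma normr_le_enorm (u : 'rV[R]_n) i : `|u ord0 i| <= enorm u.
Proof.
rewrite -(@ler_pXn2r _ 2) ?nnegrE ?sqrtr_ge0 // sqr_enorm real_normK ?num_real //.
rewrite /dotv (bigD1 i) //= -expr2 lerDl.
by apply: sumr_ge0 => j _; rewrite -expr2 sqr_ge0.
Qed.

Lemma enorm_le (u : 'rV[R]_n) (e : R) :
  0 <= e -> (forall i, `|u ord0 i| <= e) -> enorm u <= n%:R * e.
Proof.
move=> e0 ue; rewrite -(@ler_pXn2r _ 2) ?nnegrE ?sqrtr_ge0 ?mulr_ge0 //.
rewrite sqr_enorm exprMn.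
apply: (@le_trans _ _ (\sum_(i < n) e ^+ 2)).
  apply: ler_sum => i _; rewrite -expr2 -[leLHS]real_normK ?num_real //.
  by rewrite ler_pXn2r ?nnegrE.
rewrite sumr_const card_ord -[leLHS]mulr_natl ler_wpM2r ?sqr_ge0 //.
by rewrite -natrX ler_nat; case: (n) => // k; rewrite expnS leq_pmulr.
Qed.

Lemma diam_fin A (c : R) : A !=set0 -> (diam A <= c%:E)%E ->
  exists2 r, diam A = r%:E & 0 <= r <= c.
Proof.
move=> [x Ax] dc; have d0 : (0 <= diam A)%E.
  apply: (@le_trans _ _ (enorm (x - x))%:E); first by rewrite lee_fin sqrtr_ge0.
  by apply: ereal_sup_ubound; exists x => //; exists x.
by move: dc d0; case: (diam A) => [r||] //; rewrite !lee_fin => rc r0;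
  exists r => //; rewrite r0.
Qed.

Lemma diam_pow_ge0 s A : (0 <= diam_pow s A)%E.
Proof. by rewrite /diam_pow; case: eqP => // _; exact: poweR_ge0. Qed.

Lemma diam_pow_le s A (c : R) : 0 <= s -> 0 <= c -> (diam A <= c%:E)%E ->
  (diam_pow s A <= (c `^ s)%:E)%E.
Proof.
move=> s0 c0 dc; rewrite /diam_pow; case: eqP => [_|/eqP/set0P A0].
  by rewrite lee_fin powR_ge0.
have [r -> /andP[r0 rc]] := diam_fin A c A0 dc.
by rewrite poweR_EFin lee_fin ge0_ler_powR ?nnegrE.
Qed.

Lemma hausdorff_premeasure_ge0 s (delta : R) A :
  (0 <= hausdorff_premeasure s delta A)%E.
Proof.
apply: le_ereal_inf_tmp => _ [U _ <-].
by apply: nneseries_ge0 => i _ _; exact: diam_pow_ge0.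
Qed.

(** Finite covers padded with empty sets suffice: [w] sets of diameter at most [c] contribute at
    most [w] times [c] to the power [s]. One [e] bounds both the mesh and the sum. *)
Lemma hausdorff_measure_eq0 s A : 0 <= s ->
  (forall e : R, 0 < e -> exists (U : (set 'rV[R]_n)^nat) (w : nat) (c : R),
    [/\ A `<=` \bigcup_i U i, forall i, (w <= i)%N -> U i = set0,
        forall i, (diam (U i) <= c%:E)%E, 0 <= c <= e & w%:R * c `^ s <= e]) ->
  hausdorff_measure s A = 0%E.
Proof.
move=> s0 H; apply/eqP; rewrite eq_le; apply/andP; split; last first.
  apply: le_trans (hausdorff_premeasure_ge0 s 1 A) _.
  by apply: ereal_sup_ubound; exists 1 => //=; exact: ltr01.
apply: ge_ereal_sup => _ [d /= d0 <-]; apply/lee_addgt0Pr => e e0.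
rewrite add0e; have de0 : 0 < Num.min d e by rewrite lt_min d0.
have [U [w [c [AU U0 Uc /andP[c0 cde] we]]]] := H _ de0.
apply: (@le_trans _ _ (\sum_(0 <= i <oo) diam_pow s (U i))%E).
  apply: ereal_inf_lbound; exists U => //; split => // i.
  by rewrite (le_trans (Uc i)) // lee_fin (le_trans cde) // ge_min lexx.
apply: lime_le.
  by apply: is_cvg_nneseries => i _ _; exact: diam_pow_ge0.
apply: nearW => N; apply: (@le_trans _ _ (\sum_(0 <= i < N | (i < w)%N) (c `^ s)%:E)%E).
  rewrite [leRHS]big_mkcond /=; apply: lee_sum => i _.
  case: ltnP => iw; first exact: diam_pow_le.
  by rewrite U0 // /diam_pow eqxx.
rewrite sumEFin lee_fin (le_trans _ (le_trans we _)) ?ge_min ?lexx ?orbT //.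
rewrite big_const_seq iter_addr addr0 -[leLHS]mulr_natl ler_wpM2r ?powR_ge0 //.
rewrite ler_nat -size_filter.
apply: (@leq_trans (size (iota 0 w))); last by rewrite size_iota.
apply: uniq_leq_size => [|i]; first by rewrite filter_uniq // iota_uniq.
by rewrite mem_filter mem_iota => /andP[].
Qed.

End HausdorffMeasure.

Lemma exists_small_powR (R : realType) (c s e : R) : 0 <= c -> 0 < s -> 0 < e ->
  exists2 k0, 0 < k0 & forall k, k0 <= k -> (c / k) `^ s <= e.
Proof.
move=> c0 s0 e0; have es0 : 0 < e `^ s^-1 by rewrite powR_gt0.
(* Taking [c + 1] in place of [c] keeps the threshold positive when [c = 0]. *)
exists ((c + 1) / e `^ s^-1) => [|k kk].
  by rewrite divr_gt0 // ltr_wpDl.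
have k0 : 0 < k by rewrite (lt_le_trans _ kk) // divr_gt0 // ltr_wpDl.
rewrite -[leRHS](powRr1 (ltW e0)) -(mulVf (lt0r_neq0 s0)) powRrM.
rewrite ge0_ler_powR ?nnegrE ?(ltW s0) ?divr_ge0 ?(ltW k0) ?powR_ge0 //.
rewrite ler_pdivrMr //; move: kk; rewrite ler_pdivrMr // mulrC; lra.
Qed.

(** * Upper bound: the measure vanishes at the exponent n / 4 *)

Section Dimension.
Context {R : realType} {n : nat} (n_gt0 : (0 < n)%N).
Variable rho : nat -> {ffun 'I_n -> nat} -> 'I_n -> bool.

Local Notation nodes := (nodes rho).
Local Notation box := (@box R n rho).
Local Notation cantor_set := (@cantor_set R n rho).

Lemma diam_box k m : (diam (box k m) <= (2 * n%:R / (invrad k)%:R)%:E)%E.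
Proof.
apply: ge_ereal_sup => _ [x xb [y yb <-]]; rewrite lee_fin.
rewrite -mulrA mulrCA; apply: enorm_le => [|i]; first by rewrite mulr_ge0 ?invr_ge0.
have := xb i; have := yb i; rewrite !mxE !ler_norml.
by set e := _^-1; lra.
Qed.

(** At most [scale k ^ n] boxes of diameter at most [2 * n / (k.+1 * scale k ^ 4)] cover the set. At
    the exponent [n / 4] the powers of [scale k] cancel, and [2 * n / k.+1] tends to 0. *)
Lemma hausdorff_measure_cantor_set :
  hausdorff_measure (n%:R / 4%:R) cantor_set = 0%E.
Proof.
have s0 : 0 < n%:R / 4%:R :> R by rewrite divr_gt0 // ltr0n.
apply: hausdorff_measure_eq0 => [|e e0]; first exact: ltW.
have c0 : 0 <= 2 * n%:R :> R by rewrite mulr_ge0.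
have [k1 k10 H1] := @exists_small_powR _ _ _ _ c0 s0 e0.
pose k := Num.truncn (Num.max k1 (2 * n%:R / e)).
have kb : Num.max k1 (2 * n%:R / e) <= k.+1%:R.
  apply/ltW/real_truncnS_gt; exact: num_real.
have N1 : 1 <= (scale k)%:R :> R by rewrite ler1n scale_gt0.
have Nk : k.+1%:R <= (invrad k)%:R :> R.
  by rewrite ler_nat /invrad leq_pmulr // expn_gt0 scale_gt0.
exists (fun i => if (i < size (nodes k))%N then
  box k (nth [ffun => 0%N] (nodes k) i) else set0), (width k ^ n)%N,
  (2 * n%:R / (invrad k)%:R); split.
- move=> x /(_ k I) [m /= mk xb]; exists (index m (nodes k)) => //=.
  by rewrite index_mem mk nth_index.
- by move=> i; rewrite size_nodes leqNgt => /negbTE ->.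
- move=> i; case: ifP => _; first exact: diam_box.
  by apply: ge_ereal_sup => _ [x []].
- rewrite divr_ge0 //= ler_pdivrMr ?invrad_pos // [leRHS]mulrC -ler_pdivrMr //.
  by rewrite (le_trans _ Nk) // (le_trans _ kb) // le_max lexx orbT.
apply: le_trans (H1 k.+1%:R _); last by rewrite (le_trans _ kb) // le_max lexx.
have -> : 2 * n%:R / (invrad k)%:R =
    2 * n%:R / k.+1%:R * (scale k)%:R^-1 ^+ 4 :> R.
  by rewrite /invrad natrM natrX exprVn invfM mulrA.
set a := 2 * n%:R / _; set b := _ ^+ 4.
have a0 : 0 <= a by rewrite divr_ge0.
have b0 : 0 <= b by rewrite exprn_ge0 ?invr_ge0.
rewrite powRM // mulrCA ler_piMr ?powR_ge0 // /b.
rewrite -powR_mulrn ?invr_ge0 // -powRrM (mulrC 4%:R) divfK ?pnatr_eq0 //.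
rewrite powR_mulrn ?invr_ge0 // exprVn ler_pdivrMr ?exprn_gt0 ?scale_pos //.
by rewrite mul1r natrX lerXn2r ?nnegrE // ler_nat leq_width_scale.
Qed.

End Dimension.

(** * Lower bound: mass distribution over the nodes *)

Lemma size_le_sum_count (T : eqType) (I : Type) (s : seq T) (D : seq I)
    (P : I -> pred T) :
  {in s, forall m, has (P^~ m) D} ->
  (size s <= \sum_(i <- D) count (P i) s)%N.
Proof.
elim: s => [//|m s IH] h /=; rewrite big_split /= -add1n leq_add //.
  have := h m (mem_head _ _); elim: D {h IH} => [//|i D IH] /=.
  rewrite big_cons; case: (P i m) => //= /IH; lia.
by apply: IH => m' m's; apply: h; rewrite inE m's orbT.
Qed.

Section LowerBound.
Context {R : realType} {n : nat}.
Variable rho : nat -> {ffun 'I_n -> nat} -> 'I_n -> bool.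

Local Notation nodes := (nodes rho).
Local Notation cantor_set := (@cantor_set R n rho).

(** At level [k.+1] the factor [branch k] of the width is enough: as exponents of [growth k],
    [(4 * k.+1 + 1) * s] is compared with [k.+1 * n]. This needs [s <= k.+1 * (n - 4 * s)]. *)
Lemma double_invrad_powR_le (s : R) : 0 <= s -> s < n%:R / 4 ->
  exists k0, forall k, (k0 <= k)%N ->
    (2 * invrad k)%:R `^ s <= (width k ^ n)%:R.
Proof.
move=> s0 sn; have d0 : 0 < n%:R - 4 * s by lra.
exists (Num.truncn (s / (n%:R - 4 * s))).+1 => -[//|k]; rewrite ltnS => kk.
have {kk} kk : s <= k.+1%:R * (n%:R - 4 * s).
  rewrite -ler_pdivrMr // ltW // (lt_le_trans (real_truncnS_gt _)) ?num_real //.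
  by rewrite ler_nat ltnS.
rewrite double_invradS natrX -powR_mulrn // -powRrM.
apply: (@le_trans _ _ ((branch k ^ n)%:R)); last first.
  by rewrite ler_nat widthS expnMn leq_pmull // expn_gt0 width_gt0.
rewrite /branch -expnM natrX -powR_mulrn // ler_powR ?ler1n ?growth_gt0 //.
by rewrite -natr1 !natrM; lra.
Qed.

Lemma exists_level (k0 : nat) (r : R) : 0 < r -> (scale k0)%:R * r <= 1 ->
  exists k, [/\ (k0 <= k)%N, (scale k)%:R * r <= 1 & 1 < (scale k.+1)%:R * r].
Proof.
move=> r0 rk0; have ex : exists k, 1 < (scale k)%:R * r.
  exists (Num.truncn r^-1).+1; rewrite -ltr_pdivrMr // mul1r.
  rewrite (lt_le_trans (real_truncnS_gt _)) ?num_real // ler_nat.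
  exact: ltnW (ltn_scale _).
case: (ex_minnP ex) => -[|k] kr kmin.
  have := leq_scale _ _ (leq0n k0); rewrite -(ler_nat R) => h.
  by have := ler_wpM2r (ltW r0) h; lra.
exists k; split=> //.
  rewrite leqNgt; apply/negP => kk0; have := leq_scale _ _ kk0.
  by rewrite -(ler_nat R) => /(ler_wpM2r (ltW r0)); lra.
by rewrite leNgt; apply/negP => /kmin; rewrite ltnn.
Qed.

(** At a level [K] above those of all [V i], each box contains a point of the set and so meets some
    [V i]. Adding the bounds of [count_touching_powR] and dividing by [width K ^ n] gives the
    claim. *)
Lemma finite_cover_sum_ge1 (D : seq nat) (V : nat -> set 'rV[R]_n) (r : nat -> R)
    (s : R) (k0 : nat) :
  0 <= s -> s <= n%:R ->
  (forall k, (k0 <= k)%N -> (2 * invrad k)%:R `^ s <= (width k ^ n)%:R) ->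
  cantor_set `<=` \bigcup_(i in [set` D]) V i ->
  {in D, forall i, 0 < r i /\ (scale k0)%:R * r i <= 1} ->
  {in D, forall i x y j, V i x -> V i y -> `|x ord0 j - y ord0 j| <= r i} ->
  1 <= \sum_(i <- D) 5 ^+ n * r i `^ s.
Proof.
move=> s0 sn grow cov rD Vr.
have /choice[lev levP] : forall i, exists k, i \in D ->
    [/\ (k0 <= k)%N, (scale k)%:R * r i <= 1 & 1 < (scale k.+1)%:R * r i].
  move=> i; case: (boolP (i \in D)) => [iD|_]; last by exists 0%N.
  have [ri0 ri1] := rD i iD.
  by have [k kP] := exists_level k0 _ ri0 ri1; exists k.
pose K := (\max_(i <- D) lev i).+1.
have w0 : 0 < (width K ^ n)%:R :> R by rewrite ltr0n expn_gt0 width_gt0.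
rewrite -(ler_pM2l w0) mulr1 mulr_sumr.
have : (width K ^ n)%:R <=
    (\sum_(i <- D) count (touches rho (V i) K) (nodes K))%N%:R :> R.
  rewrite ler_nat -(size_nodes rho); apply: size_le_sum_count => m mK.
  have [x [xE xb]] := @box_cantor_set R n rho K m mK.
  have [i /= iD xV] := cov x xE.
  by apply/hasP; exists i => //; apply/asboolP; exists x.
move=> /le_trans; apply; rewrite natr_sum big_seq [leRHS]big_seq.
apply: ler_sum => i iD.
have [ki ri1 ri2] := levP i iD; have [ri0 _] := rD i iD.
apply: (count_touching_powR rho (V i) (lev i)) => //.
- by rewrite ltnS; exact: leq_bigmax_seq.
- exact: grow.
- by move=> x y j; exact: Vr.
Qed.

(** Covering sets are to be enlarged to open ones. Doubling does this at a constant factor unless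
    [r = 0], whence the additive error [e]. *)
Lemma exists_enlarged_radius (r s d e : R) :
  0 <= r -> r <= d -> 0 <= s -> 0 < d -> 0 < e ->
  exists r', [/\ r < r', r' <= 2 * d & r' `^ s <= 2 `^ s * r `^ s + e].
Proof.
move=> r0 rd s0 d0 e0; have [->|rn0] := eqVneq r 0; last first.
  have rp : 0 < r by rewrite lt_neqAle eq_sym rn0.
  exists (2 * r); split; [lra|lra|].
  by rewrite powRM //; lra.
have [->|sn0] := eqVneq s 0.
  by exists d; split; [lra|lra|rewrite !powRr0; lra].
have sp : 0 < s by rewrite lt_neqAle eq_sym sn0.
exists (Num.min d (e `^ s^-1)); rewrite lt_min d0 powR_gt0 // powR0 // mulr0 add0r.
split=> //; first by rewrite ge_min; apply/orP; left; lra.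
rewrite -[leRHS](powRr1 (ltW e0)) -(mulVf sn0) powRrM.
rewrite ge0_ler_powR ?nnegrE ?powR_ge0 ?le_min ?(ltW d0) ?powR_ge0 //.
by rewrite ge_min lexx orbT.
Qed.

Lemma hausdorff_measure_cantor_set_neq0 (s : R) : 0 <= s -> s < n%:R / 4 ->
  hausdorff_measure s cantor_set != 0%E.
Proof.
move=> s0 sn; have sn' : s <= n%:R by have := ler0n R n; lra.
have [k0 grow] := double_invrad_powR_le s s0 sn.
(* An enlarged radius is at most [2 * d], and [scale k0 * (2 * d) = 1] is what
   [finite_cover_sum_ge1] requires. *)
pose d : R := (2 * (scale k0)%:R)^-1.
have N0 := @scale_pos R k0.
have d0 : 0 < d by rewrite invr_gt0 mulr_gt0.
have Nd : (scale k0)%:R * (2 * d) = 1.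
  by rewrite /d; field; rewrite gt_eqF.
have f0 : 0 < 5 ^+ n :> R by rewrite exprn_gt0.
have p0 : 0 < 2 `^ s :> R by rewrite powR_gt0.
(* The additive errors [e / 2 ^ i.+1] sum to at most [e] and so consume [5 ^ n * e = 1 / 2] of the
   lower bound 1; the other half bounds the sum of the cover from below. *)
pose e : R := (2 * 5 ^+ n)^-1.
have e0 : 0 < e by rewrite invr_gt0 mulr_gt0.
have fe : 5 ^+ n * e = 2^-1 by rewrite /e; field; rewrite gt_eqF.
suff : ((e / 2 `^ s)%:E <= hausdorff_premeasure s d cantor_set)%E.
  move=> h; rewrite gt_eqF //; apply: (@lt_le_trans _ _ (e / 2 `^ s)%:E).
    by rewrite lte_fin divr_gt0.
  by apply: le_trans h _; apply: ereal_sup_ubound; exists d.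
apply: le_ereal_inf_tmp => _ [U [cov Ud] <-].
pose q i := fine (diam (U i)).
have qP i : U i !=set0 ->
    [/\ diam (U i) = (q i)%:E, 0 <= q i, q i <= d
      & diam_pow s (U i) = (q i `^ s)%:E].
  move=> Ui0; have [r dr /andP[r0 rd]] := diam_fin (U i) d Ui0 (Ud i).
  have qr : q i = r by rewrite /q dr.
  rewrite /diam_pow; case: eqP Ui0 => [-> [] //|_ _].
  by rewrite dr qr poweR_EFin.
have ei0 i : 0 < e / (2 ^ i.+1)%:R by rewrite divr_gt0 // ltr0n expn_gt0.
have /choice[r rP] : forall i, exists r, U i !=set0 ->
    [/\ q i < r, r <= 2 * d & r `^ s <= 2 `^ s * q i `^ s + e / (2 ^ i.+1)%:R].
  move=> i; case: (pselect (U i !=set0)) => [Ui0|]; last by exists 0.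
  have [_ q0 qd _] := qP i Ui0.
  by have [r' r'P] := exists_enlarged_radius _ _ _ _ q0 qd s0 d0 (ei0 i); exists r'.
(* Two points, each moved by less than [(r i - q i) / 2], gain at most [r i - q i] over the
   differences in [U i], which are at most [q i]. *)
pose V i := \bigcup_(u in U i) ball u ((r i - q i) / 2).
have Vopen i : open (V i) by apply: bigcup_open => u _; exact: ball_open.
have covV : cantor_set `<=` cover [set i | U i !=set0] V.
  move=> x /cov[i _ xU]; have Ui0 : U i !=set0 by exists x.
  exists i => //; exists x => //; apply: ballxx.
  by have [qr _ _] := rP i Ui0; rewrite divr_gt0 // subr_gt0.
have Vr i : U i !=set0 -> forall x y j, V i x -> V i y -> `|x ord0 j - y ord0 j| <= r i.
  move=> Ui0 x y j [u Uu [_ /(_ ord0 j) ux]] [v Uv [_ /(_ ord0 j) vy]].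
  have [dq _ _ _] := qP i Ui0.
  have uv : `|u ord0 j - v ord0 j| <= q i.
    have := normr_le_enorm (u - v) j; rewrite !mxE => /le_trans; apply.
    by rewrite -lee_fin -dq; apply: ereal_sup_ubound; exists u => //; exists v.
  move: ux vy uv; rewrite /ball /= ltr_distl ltr_distl !ler_norml.
  move=> /andP[u1 u2] /andP[v1 v2]; move: (r i) (q i) u1 u2 v1 v2 => a b; lra.
have cptE : cover_compact cantor_set by rewrite -compact_cover; exact: compact_cantor_set.
have [D DU covD] := cptE _ _ _ (fun i _ => Vopen i) covV.
have DU' i : i \in D -> U i !=set0 by move=> /DU /set_mem.
pose f i : \bar R := ((2 `^ s)%:E * diam_pow s (U i) + (e / (2 ^ i.+1)%:R)%:E)%E.
have f_ge0 i : (0 <= f i)%E.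
  by rewrite adde_ge0 // ?mule_ge0 ?lee_fin ?(ltW p0) ?diam_pow_ge0 // ltW.
have h1 : 1 <= \sum_(i <- D) 5 ^+ n * r i `^ s.
  apply: (finite_cover_sum_ge1 D V r s k0) => // i iD.
    have [qr rd _] := rP i (DU' i iD); have [_ q0 _ _] := qP i (DU' i iD).
    by split; [lra|rewrite -[leRHS]Nd ler_pM2l].
  exact: Vr (DU' i iD).
have h2 : ((\sum_(i <- D) r i `^ s)%:E <= \sum_(i <- D) f i)%E.
  rewrite -sumEFin big_seq [leRHS]big_seq; apply: lee_sum => i iD.
  have [_ _ rs] := rP i (DU' i iD); have [_ _ _ ds] := qP i (DU' i iD).
  by rewrite /f ds -EFinM -EFinD lee_fin.
have h3 : (\sum_(i <- D) f i <= \sum_(0 <= i <oo) f i)%E.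
  pose B := (\max_(i <- D) i).+1.
  apply: (@le_trans _ _ (\sum_(0 <= i < B) f i)%E); last exact: nneseries_lim_ge.
  have pD : perm_eq D [seq i <- index_iota 0 B | i \in D].
    apply: uniq_perm => [||i]; first exact: fset_uniq.
      by rewrite filter_uniq // iota_uniq.
    rewrite mem_filter mem_index_iota /=; case: (boolP (i \in D)) => //= iD.
    by rewrite ltnS leq_bigmax_seq.
  rewrite (perm_big _ pD) big_filter.
  rewrite [leLHS]big_mkcond; apply: lee_sum => i _; case: ifP => _ //; exact: f_ge0.
have h4 : (\sum_(0 <= i <oo) f i <=
    (2 `^ s)%:E * \sum_(0 <= i <oo) diam_pow s (U i) + e%:E)%E.
  rewrite -nneseriesZl; last by move=> i _; exact: diam_pow_ge0.
  apply: (@epsilon_trick R (fun i => (2 `^ s)%:E * diam_pow s (U i))%E e xpredT) => [i|].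
    by rewrite mule_ge0 ?lee_fin ?(ltW p0) ?diam_pow_ge0.
  exact: ltW.
have S0 : (0 <= \sum_(0 <= i <oo) diam_pow s (U i))%E.
  by apply: nneseries_ge0 => i _ _; exact: diam_pow_ge0.
have := le_trans h2 (le_trans h3 h4).
move: S0; set S := (\sum_(0 <= i <oo) _)%E; case: S => [S||//] S0; last first.
  by rewrite leey.
rewrite -EFinM -EFinD !lee_fin => h5.
rewrite ler_pdivrMr // [leRHS]mulrC.
move: h1; rewrite -mulr_sumr => h1.
have := ler_wpM2l (ltW f0) h5; rewrite mulrDr fe => h6.
rewrite -(ler_pM2l f0) fe; lra.
Qed.

Lemma hausdorff_dim_cantor_set : (0 < n)%N ->
  hausdorff_dim cantor_set = (n%:R / 4%:R)%:E.
Proof.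
move=> n0; apply/eqP; rewrite eq_le; apply/andP; split.
  apply: ereal_inf_lbound; exists (n%:R / 4%:R) => //; split.
    by rewrite divr_ge0.
  exact: hausdorff_measure_cantor_set.
apply: le_ereal_inf_tmp => _ [s [s0 Hs] <-]; rewrite lee_fin leNgt.
by apply/negP => sn; have /eqP := hausdorff_measure_cantor_set_neq0 s s0 sn.
Qed.

End LowerBound.

(** * Avoiding the angles *)

(** The ring is left general because the form is taken over the reals, over [int] at the numerators,
    and over ['F_2] to find its parity. *)
Definition angle_form (T : comNzRingType) (n : nat) (p q : T) (U V : 'I_n -> T) : T :=
  q * (\sum_i U i * V i) ^+ 2 - p * ((\sum_i U i * U i) * (\sum_i V i * V i)).

Lemma rmorph_angle_form (S T : comNzRingType) (f : {rmorphism S -> T}) n (p q : S)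
    (U V : 'I_n -> S) :
  f (angle_form S n p q U V) = angle_form T n (f p) (f q) (f \o U) (f \o V).
Proof.
rewrite /angle_form rmorphB /= rmorphM rmorphXn rmorphM rmorphM !rmorph_sum /=.
congr (_ * _ ^+ 2 - _ * (_ * _)); by apply: eq_bigr => i _; rewrite rmorphM.
Qed.

Lemma sum_indicM (T : nzRingType) n (i j : 'I_n) :
  \sum_(l < n) (l == i)%:R * (l == j)%:R = (i == j)%:R :> T.
Proof.
rewrite (bigD1 i) //= eqxx mul1r big1 ?addr0 // => l /negbTE ->.
by rewrite mul0r.
Qed.

Lemma F2_neq0 (a : 'F_2) : a != 0 -> a = 1.
Proof. by case: a => -[|[|//]] h // _; apply: val_inj. Qed.

Lemma natr_F2 (m : nat) (b : bool) : (2 * m + b)%:R = b%:R :> 'F_2.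
Proof. by rewrite natrD natrM pchar_Fp_0 // mul0r add0r. Qed.

(* Modulo 2 only [x] and [z] contribute to the differences, by unit vectors. If
   [p] is odd these are distinct and the form is [- p]; otherwise [q] is odd,
   they are equal and the form is [q - p]. *)
Lemma angle_form_neq0 n (p q : int) (i j : 'I_n) (x y z v : 'I_n -> nat) :
  coprime `|p| `|q| -> (i == j) = (p%:~R == 0 :> 'F_2) ->
  angle_form int n p q
    (fun l => (2 * x l + (l == i))%:Z - (2 * y l)%:Z)
    (fun l => (2 * z l + (l == j))%:Z - (2 * v l)%:Z) != 0.
Proof.
move=> cpq ij; set F := angle_form _ _ _ _ _ _.
suff : (F%:~R : 'F_2) != 0 by apply: contraNneq => ->.
have toF2 m m' (l l' : 'I_n) :
    ((2 * m + (l == l'))%:Z - (2 * m')%:Z)%:~R = (l == l')%:R :> 'F_2.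
  by rewrite rmorphB /= -!pmulrn natr_F2 -[(2 * m')%N]addn0 (natr_F2 _ false) subr0.
have sumF i1 i2 (a b a' b' : 'I_n -> nat) :
    \sum_l ((2 * a l + (l == i1))%:Z - (2 * b l)%:Z)%:~R *
      ((2 * a' l + (l == i2))%:Z - (2 * b' l)%:Z)%:~R = (i1 == i2)%:R :> 'F_2.
  by rewrite -sum_indicM; apply: eq_bigr => l _; rewrite !toF2.
rewrite /F (rmorph_angle_form _ _ (intr : {rmorphism int -> 'F_2})) /angle_form.
rewrite /= !sumF !eqxx !mulr1 ij.
have [p0|/F2_neq0 ->] := eqVneq (p%:~R : 'F_2) 0.
  have q0 : (q%:~R : 'F_2) != 0.
    apply: contraL cpq => q0; rewrite /coprime.
    have ch := pchar_Fp (isT : prime 2).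
    have dp : (2 %| p)%Z by rewrite (dvdz_pcharf ch) p0.
    have dq : (2 %| q)%Z by rewrite (dvdz_pcharf ch).
    apply/eqP => g1; have : (2 %| gcdn `|p| `|q|)%N.
      by rewrite dvdn_gcd; move: dp dq; rewrite !dvdzE => -> ->.
    by rewrite g1.
  by rewrite (F2_neq0 _ q0) p0 expr1n mulr1 subr0 oner_neq0.
by rewrite expr0n mulr0 sub0r oppr_eq0 oner_neq0.
Qed.

(** * Stability of the form under perturbation *)

Section Perturbation.
Context {R : realType} {n : nat}.

(** As [e <= H], the entries of [U] and [V] are at most [2 * H] in absolute value; a product then
    moves by at most [2 * H * e + e * H]. *)
Lemma sum_mul_close (H e : R) (A B U V : 'I_n -> R) :
  0 <= e -> e <= H ->
  (forall i, `|A i| <= H) -> (forall i, `|B i| <= H) ->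
  (forall i, `|U i - A i| <= e) -> (forall i, `|V i - B i| <= e) ->
  [/\ `|\sum_i U i * V i - \sum_i A i * B i| <= n%:R * (3 * H * e),
      `|\sum_i A i * B i| <= n%:R * H ^+ 2 &
      `|\sum_i U i * V i| <= n%:R * (4 * H ^+ 2)].
Proof.
move=> e0 eH AH BH UA VB; have H0 : 0 <= H by exact: le_trans eH.
have nsum (F : 'I_n -> R) c : (forall i, `|F i| <= c) -> `|\sum_i F i| <= n%:R * c.
  move=> Fc; rewrite (le_trans (ler_norm_sum _ _ _)) //.
  rewrite (le_trans (ler_sum _ (fun i _ => Fc i))) //.
  by rewrite sumr_const card_ord mulr_natl.
have U2 i : `|U i| <= 2 * H.
  rewrite -(subrK (A i) (U i)) (le_trans (ler_normD _ _)) //.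
  by have := AH i; have := UA i; lra.
have V2 i : `|V i| <= 2 * H.
  rewrite -(subrK (B i) (V i)) (le_trans (ler_normD _ _)) //.
  by have := BH i; have := VB i; lra.
split.
- rewrite -sumrB; apply: nsum => i.
  have -> : U i * V i - A i * B i = U i * (V i - B i) + (U i - A i) * B i by ring.
  rewrite (le_trans (ler_normD _ _)) // !normrM.
  have h1 := ler_pM (normr_ge0 (U i)) (normr_ge0 _) (U2 i) (VB i).
  have h2 := ler_pM (normr_ge0 _) (normr_ge0 (B i)) (UA i) (BH i).
  by rewrite (le_trans (lerD h1 h2)) //; lra.
- by apply: nsum => i; rewrite normrM expr2 ler_pM.
- apply: nsum => i; rewrite normrM (_ : 4 * H ^+ 2 = 2 * H * (2 * H)); last by ring.
  by rewrite ler_pM.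
Qed.

Lemma mul_close (a b u v M d : R) :
  `|a| <= M -> `|b| <= M -> `|u| <= 4 * M -> `|v| <= 4 * M ->
  `|u - a| <= d -> `|v - b| <= d -> `|u * v - a * b| <= 5 * M * d.
Proof.
move=> aM bM uM vM ua vb.
have -> : u * v - a * b = u * (v - b) + (u - a) * b by ring.
rewrite (le_trans (ler_normD _ _)) // !normrM.
have h1 := ler_pM (normr_ge0 u) (normr_ge0 _) uM vb.
have h2 := ler_pM (normr_ge0 _) (normr_ge0 b) ua bM.
by rewrite (le_trans (lerD h1 h2)) //; lra.
Qed.

(** Each product of two sums is handled by [mul_close] with [M = n * H ^ 2] and [d = 3 * n * H * e],
    whence the constant 15. *)
Lemma angle_form_close (H e p q : R) (A B U V : 'I_n -> R) :
  0 <= e -> e <= H ->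
  (forall i, `|A i| <= H) -> (forall i, `|B i| <= H) ->
  (forall i, `|U i - A i| <= e) -> (forall i, `|V i - B i| <= e) ->
  `|angle_form R n p q U V - angle_form R n p q A B| <=
    (`|p| + `|q|) * (15 * n%:R ^+ 2 * H ^+ 3 * e).
Proof.
move=> e0 eH AH BH UA VB.
have [d1 a1 u1] := sum_mul_close H e A B U V e0 eH AH BH UA VB.
have [d2 a2 u2] := sum_mul_close H e A A U U e0 eH AH AH UA UA.
have [d3 a3 u3] := sum_mul_close H e B B V V e0 eH BH BH VB VB.
rewrite /angle_form !expr2.
set uv := \sum_i U i * V i in d1 u1 *; set ab := \sum_i A i * B i in d1 a1 *.
set uu := \sum_i U i * U i in d2 u2 *; set aa := \sum_i A i * A i in d2 a2 *.
set vv := \sum_i V i * V i in d3 u3 *; set bb := \sum_i B i * B i in d3 a3 *.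
have e4 : n%:R * (4 * H ^+ 2) = 4 * (n%:R * H ^+ 2) :> R by ring.
rewrite e4 in u1 u2 u3.
have h1 := mul_close ab ab uv uv _ _ a1 a1 u1 u1 d1 d1.
have h2 := mul_close aa bb uu vv _ _ a2 a3 u2 u3 d2 d3.
have -> : q * (uv * uv) - p * (uu * vv) - (q * (ab * ab) - p * (aa * bb)) =
  - (p * (uu * vv - aa * bb)) + q * (uv * uv - ab * ab) by ring.
have -> : (`|p| + `|q|) * (15 * n%:R ^+ 2 * H ^+ 3 * e) =
  `|p| * (5 * (n%:R * H ^+ 2) * (n%:R * (3 * H * e))) +
  `|q| * (5 * (n%:R * H ^+ 2) * (n%:R * (3 * H * e))) by ring.
rewrite (le_trans (ler_normD _ _)) // normrN !normrM.
by rewrite lerD // ler_wpM2l.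
Qed.

End Perturbation.

Lemma injective_nat_unbounded (f : nat -> nat) (K : nat) :
  injective f -> exists j, (K <= f j)%N.
Proof.
move=> fi; apply: contrapT => /forallNP H.
have : (size (map f (iota 0 K.+1)) <= size (iota 0 K))%N.
  apply: uniq_leq_size; first by rewrite map_inj_uniq // iota_uniq.
  move=> _ /mapP[j _ ->]; rewrite mem_iota /= add0n ltnNge; apply/negP.
  exact: H.
by rewrite size_map !size_iota ltnn.
Qed.

Section Avoidance.
Context {R : realType} {n : nat} (i0 i1 : 'I_n) (i01 : i0 != i1).

(* [(b, M, a, c, j)] prescribes the direction [i0] for the nodes near [a / M],
   and [i1] or [i0], according to [b], for those near [c / M]. The index [j] is
   a dummy that makes every prescription occur at infinitely many levels. *)
Definition code : Type :=
  bool * nat * {ffun 'I_n -> int} * {ffun 'I_n -> int} * nat.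

(** The test uses the unperturbed point [2 * m i / scale k], since [parity] is defined through it.
    The tolerance 2 is 1 for [box_near] plus 1 for the floor; a separation of 5 exceeds 2 + 1 +
    1. *)
Definition near_cell (M : nat) (a : {ffun 'I_n -> int}) (k : nat)
    (m : {ffun 'I_n -> nat}) : bool :=
  [forall i, `|M%:R * ((2 * m i)%:R / (scale k)%:R) - (a i)%:~R| <= 2 :> R].

Definition parity (k : nat) (m : {ffun 'I_n -> nat}) (i : 'I_n) : bool :=
  if (choice.unpickle k : option code) is Some (b, M, a, c, _) then
    if near_cell M a k m then i == i0
    else if near_cell M c k m then i == (if b then i1 else i0)
    else false
  else false.

Local Notation box := (@box R n parity).
Local Notation cantor_set := (@cantor_set R n parity).
Local Notation anchor := (anchor parity).

Lemma exists_separation (x y : 'rV[R]_n) : x != y -> exists M0 : nat,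
  forall M, (M0 <= M)%N -> exists i, 5 <= M%:R * `|x ord0 i - y ord0 i|.
Proof.
move=> xy; have [i xyi] : exists i, x ord0 i != y ord0 i.
  apply: contrapT => /forallNP H.
  move/eqP: xy; apply; apply/rowP => i; apply/eqP; apply: contrapT => /negP.
  exact: H.
have d0 : 0 < `|x ord0 i - y ord0 i| by rewrite normr_gt0 subr_eq0.
exists (Num.truncn (5 / `|x ord0 i - y ord0 i|)).+1 => M MM; exists i.
rewrite -ler_pdivrMr // ltW // (lt_le_trans (real_truncnS_gt _)) ?num_real //.
by rewrite ler_nat.
Qed.

(** The parity and the radius each move [x] by at most [1 / scale k] from the unperturbed point, and
    [2 * M <= k < scale k]. *)
Lemma box_near (M k : nat) m (x : 'rV[R]_n) i : (2 * M <= k)%N -> box k m x ->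
  `|M%:R * x ord0 i - M%:R * ((2 * m i)%:R / (scale k)%:R)| <= 1.
Proof.
move=> Mk xb; rewrite -mulrBr normrM ger0_norm //.
have s0 := @scale_pos R k.
have h : `|x ord0 i - (2 * m i)%:R / (scale k)%:R| <= 2 / (scale k)%:R.
  have e'le : (invrad k)%:R^-1 <= (scale k)%:R^-1 :> R.
    rewrite lef_pV2 ?posrE ?scale_pos ?invrad_pos // ler_nat.
    exact: leq_scale_invrad.
  have := xb i; rewrite /node_coord /anchor natrD mulrDl.
  have : (nat_of_bool (parity k m i))%:R / (scale k)%:R <= (scale k)%:R^-1 :> R.
    by rewrite ler_pdivrMr // mulVf ?gt_eqF // lern1 leq_b1.
  have : 0 <= (nat_of_bool (parity k m i))%:R / (scale k)%:R :> R.
    by rewrite divr_ge0.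
  rewrite !ler_norml; move: (_ / _) (_ / _) e'le => u w.
  by move: (_^-1) (_^-1) => e f; lra.
apply: le_trans (ler_wpM2l (ler0n R M) h) _.
rewrite mulrA ler_pdivrMr // mul1r -natrM ler_nat mulnC.
exact: leq_trans Mk (ltnW (ltn_scale k)).
Qed.

Definition cell_of (M : nat) (x : 'rV[R]_n) : {ffun 'I_n -> int} :=
  [ffun i => Num.floor (M%:R * x ord0 i)].

Lemma near_cell_self (M k : nat) m (x : 'rV[R]_n) : (2 * M <= k)%N ->
  box k m x -> near_cell M (cell_of M x) k m.
Proof.
move=> Mk xb; apply/forallP => i; rewrite ffunE.
have := box_near M k m x i Mk xb.
have /andP[] := floor_itv (M%:R * x ord0 i); rewrite intrD mulr1z.
move: (M%:R * x _ _) (M%:R * (_ / _)) (_ %:~R) => u t a.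
by rewrite !ler_norml; lra.
Qed.

Lemma near_cell_other (M k : nat) m (x y : 'rV[R]_n) i : (2 * M <= k)%N ->
  box k m y -> 5 <= M%:R * `|x ord0 i - y ord0 i| ->
  ~~ near_cell M (cell_of M x) k m.
Proof.
move=> Mk yb xy; apply/negP => /forallP/(_ i); rewrite ffunE.
have := box_near M k m y i Mk yb; move: xy.
rewrite -[M%:R in X in X -> _]ger0_norm // -normrM mulrBr.
have /andP[] := floor_itv (M%:R * x ord0 i); rewrite intrD mulr1z.
move: (M%:R * x _ _) (M%:R * y _ _) (M%:R * (_ / _)) (_ %:~R) => u w t a.
by rewrite ler_normr !ler_norml => h1 h2 /orP[]; lra.
Qed.

(** The points [y] and [v] receive the same, even, numerators modulo 2, so they may coincide; this
    is how three points are covered. *)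
Lemma exists_level_parity (b : bool) (K : nat) (x y z v : 'rV[R]_n) :
  x != y -> x != z -> x != v -> z != y -> z != v ->
  exists2 k, (K <= k)%N &
    forall mx my mz mv, box k mx x -> box k my y -> box k mz z -> box k mv v ->
    forall i, [/\ parity k mx i = (i == i0), parity k my i = false,
      parity k mz i = (i == (if b then i1 else i0)) & parity k mv i = false].
Proof.
move=> /exists_separation[M1 H1] /exists_separation[M2 H2].
move=> /exists_separation[M3 H3] /exists_separation[M4 H4].
move=> /exists_separation[M5 H5].
pose M := (M1 + M2 + M3 + M4 + M5)%N.
have [j1 {}H1] := H1 M ltac:(lia); have [j2 {}H2] := H2 M ltac:(lia).
have [j3 {}H3] := H3 M ltac:(lia); have [j4 {}H4] := H4 M ltac:(lia).
have [j5 {}H5] := H5 M ltac:(lia).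
pose c j : code := (b, M, cell_of M x, cell_of M z, j).
have cinj : injective (fun j => choice.pickle (c j)).
  by move=> j j' /(pcan_inj choice.pickleK) [].
(* The level must pass [K], and also [2 * M] for [box_near] to apply. *)
have [j jK] := injective_nat_unbounded _ (K + 2 * M)%N cinj.
exists (choice.pickle (c j)); first by lia.
have kM : (2 * M <= choice.pickle (c j))%N by lia.
have pk : choice.unpickle (choice.pickle (c j)) = Some (c j) by rewrite choice.pickleK.
move: pk kM {jK}; move: (choice.pickle (c j)) => k pk kM mx my mz mv xb yb zb vb i.
rewrite /parity pk /= (near_cell_self M k mx x kM xb).
rewrite (negbTE (near_cell_other M k my x y j1 kM yb H1)).
rewrite (negbTE (near_cell_other M k mz x z j2 kM zb H2)).
rewrite (negbTE (near_cell_other M k mv x v j3 kM vb H3)).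
rewrite (negbTE (near_cell_other M k my z y j4 kM yb H4)).
rewrite (negbTE (near_cell_other M k mv z v j5 kM vb H5)).
by rewrite (near_cell_self M k mz z kM zb).
Qed.

Lemma cantor_set_diff (x y : 'rV[R]_n) i : cantor_set x -> cantor_set y ->
  `|x ord0 i - y ord0 i| <= 2.
Proof.
have root t : cantor_set t -> box 0 [ffun => 0%N] t.
  by move=> /(_ 0%N I) [m /=]; rewrite inE => /eqP ->.
move=> /root /(_ i) + /root /(_ i).
have -> : (invrad 0)%:R^-1 = 1 :> R by rewrite /invrad exp1n invr1.
by rewrite !ler_norml; lra.
Qed.

Lemma angle_form_cantor_set_neq0 (p q : int) (x y z v : 'rV[R]_n) :
  coprime `|p| `|q| ->
  cantor_set x -> cantor_set y -> cantor_set z -> cantor_set v ->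
  x != y -> x != z -> x != v -> z != y -> z != v ->
  angle_form R n p%:~R q%:~R (fun i => (x - y) ord0 i) (fun i => (z - v) ord0 i)
    != 0.
Proof.
move=> cpq Ex Ey Ez Ev xy xz xv zy zv; apply/eqP => F0.
pose b : bool := p%:~R != 0 :> 'F_2.
pose Q : R := `|p%:~R| + `|q%:~R|.
(* The perturbation error computed below is [240 * n ^ 2 * Q / k.+1], hence less than 1 once
   [C < k.+1]. *)
pose C : R := 480 * n%:R ^+ 2 * Q.
have [k kC par] := exists_level_parity b (Num.truncn C) x y z v xy xz xv zy zv.
have [mx _ xb] := Ex k I; have [my _ yb] := Ey k I.
have [mz _ zb] := Ez k I; have [mv _ vb] := Ev k I.
have {}par := par _ _ _ _ xb yb zb vb.
pose N : R := (scale k)%:R; have N0 : 0 < N := @scale_pos R k.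
have N1 : 1 <= N by rewrite ler1n scale_gt0.
pose j := if b then i1 else i0.
pose U l : int := (2 * mx l + (l == i0))%:Z - (2 * my l)%:Z.
pose V l : int := (2 * mz l + (l == j))%:Z - (2 * mv l)%:Z.
have nz : angle_form int n p q U V != 0.
  apply: angle_form_neq0 => //; rewrite /j /b.
  by have [p0|p0] /= := eqVneq (p%:~R : 'F_2) 0; [rewrite eqxx|exact: negbTE].
have {}nz : 1 <= `|angle_form R n p%:~R q%:~R (intr \o U) (intr \o V)|.
  rewrite -(rmorph_angle_form _ _ (intr : {rmorphism int -> R})) -intr_norm.
  by rewrite -[1]/(1%:~R) ler_int -gtz0_ge1 normr_gt0.
(* Everything is multiplied by [N]: a numerator is within [N / invrad k] of [N] times a coordinate,
   and a difference involves two of them. *)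
pose e : R := 2 * (N / (invrad k)%:R).
have Re : 0 < (invrad k)%:R :> R := @invrad_pos R k.
have e0 : 0 <= e by rewrite mulr_ge0 // divr_ge0 // ltW.
have eH : e <= 2 * N.
  rewrite /e ler_pM2l // ler_pdivrMr // ler_peMr ?(ltW N0) //.
  by rewrite ler1n invrad_gt0.
have AH (s t : 'rV[R]_n) (Es : cantor_set s) (Et : cantor_set t) i :
    `|N * (s - t) ord0 i| <= 2 * N.
  rewrite normrM (ger0_norm (ltW N0)) mulrC ler_pM2r // !mxE.
  exact: cantor_set_diff.
have close (s t : 'rV[R]_n) ms mt : box k ms s -> box k mt t -> forall i,
    `|((anchor k ms i)%:Z - (anchor k mt i)%:Z)%:~R - N * (s - t) ord0 i| <= e.
  move=> sb tb i; have := sb i; have := tb i.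
  rewrite intrB -!pmulrn /node_coord !mxE => h1 h2.
  have cN a : a%:R = N * (a%:R / N) by rewrite mulrC divfK ?gt_eqF.
  rewrite [(anchor k ms i)%:R]cN [(anchor k mt i)%:R]cN -mulrBr -mulrBr normrM.
  rewrite (ger0_norm (ltW N0)) /e mulrCA ler_pM2l //.
  move: h1 h2; rewrite -/N !ler_norml.
  by move: (_ / _) (_ / _) (_^-1) => u w f; lra.
have UA i : `|(U i)%:~R - N * (x - y) ord0 i| <= e.
  have := close x y mx my xb yb i; rewrite /anchor.
  by have [-> -> _ _] := par i; rewrite addn0.
have VB i : `|(V i)%:~R - N * (z - v) ord0 i| <= e.
  have := close z v mz mv zb vb i; rewrite /anchor.
  by have [_ _ -> ->] := par i; rewrite addn0.
have := angle_form_close (2 * N) e p%:~R q%:~R _ _ (intr \o U) (intr \o V) e0 eH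
  (AH x y Ex Ey) (AH z v Ez Ev) UA VB.
(* Homogeneity of degree 4 transfers the vanishing [F0] to the rescaled differences. *)
have -> : angle_form R n p%:~R q%:~R (fun i => N * (x - y) ord0 i)
    (fun i => N * (z - v) ord0 i) = 0.
  have sumN (a c : 'I_n -> R) :
      \sum_i N * a i * (N * c i) = N ^+ 2 * \sum_i a i * c i.
    by rewrite mulr_sumr; apply: eq_bigr => i _; ring.
  rewrite /angle_form !sumN.
  have := congr1 ( *%R (N ^+ 4)) F0; rewrite mulr0 /angle_form => F0'.
  by rewrite -[RHS]F0'; ring.
rewrite subr0 -/Q => h; have {nz} h := le_trans nz h.
have eE : 15 * n%:R ^+ 2 * (2 * N) ^+ 3 * e = 240 * n%:R ^+ 2 / k.+1%:R :> R.
  rewrite /e /invrad natrM natrX -/N; field.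
  by rewrite (gt_eqF N0) andbT addrC natr1 pnatr_eq0.
rewrite eE in h.
have C1 : C < k.+1%:R.
  rewrite (lt_le_trans (real_truncnS_gt _)) ?num_real // ler_nat ltnS.
  exact: kC.
have k0 : 0 < k.+1%:R :> R by rewrite ltr0n.
move: h; rewrite mulrA ler_pdivlMr // mul1r.
have : 0 <= C by rewrite /C !mulr_ge0 // ?exprn_ge0 // addr_ge0.
have -> : Q * (240 * n%:R ^+ 2) = C / 2 by rewrite /C; field.
by move: C1; lra.
Qed.

End Avoidance.

Lemma is_angle_angle_form (R : realType) (n : nat) (u v : 'rV[R]_n) (alpha : R)
    (q : rat) :
  u != 0 -> v != 0 -> is_angle u v alpha -> cos alpha ^+ 2 = ratr q ->
  angle_form R n (numq q)%:~R (denq q)%:~R (fun i => u ord0 i) (fun i => v ord0 i)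
    = 0.
Proof.
have enorm_gt0 (w : 'rV[R]_n) : w != 0 -> 0 < enorm w.
  move=> w0; rewrite lt_neqAle sqrtr_ge0 andbT eq_sym.
  apply: contraNneq w0 => e0; apply/eqP/rowP => i; rewrite mxE.
  by apply/eqP; rewrite -normr_le0 -e0; exact: normr_le_enorm.
move=> /enorm_gt0 u0 /enorm_gt0 v0 [_ ->] h.
have d0 : (denq q)%:~R != 0 :> R by rewrite intr_eq0 denq_neq0.
rewrite /angle_form -!/(dotv _ _) -!sqr_enorm; apply/eqP; rewrite subr_eq0.
apply/eqP; rewrite /ratr in h.
have -> : dotv u v = dotv u v / (enorm u * enorm v) * (enorm u * enorm v).
  by rewrite divfK // mulf_neq0 ?gt_eqF.
rewrite exprMn h exprMn; field; exact: d0.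
Qed.

Theorem theorem3p2 (R : realType) (n : nat) (hn : (2 <= n)%N) :
  exists E : set 'rV[R]_n,
    [/\ compact E,
        hausdorff_dim E = (n%:R / 4%:R)%:E,
        ~ (exists (x y z : 'rV[R]_n) (alpha : R),
             [/\ E x, E y & E z] /\
             [/\ uniq [:: x; y; z],
                 points_form_angle x y z alpha
               & is_rational (cos alpha ^+ 2)])
      & ~ (exists (x y z v : 'rV[R]_n) (alpha : R),
             [/\ E x, E y, E z & E v] /\
             [/\ uniq [:: x; y; z; v],
                 is_angle (x - y) (z - v) alpha
               & is_rational (cos alpha ^+ 2)])].
Proof.
pose i0 : 'I_n := Ordinal (ltnW hn); pose i1 : 'I_n := Ordinal hn.
have i01 : i0 != i1 by [].
pose E := cantor_set (R := R) (@parity R n i0 i1).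
have avoid (x y z v : 'rV[R]_n) alpha : E x -> E y -> E z -> E v ->
    x != y -> x != z -> x != v -> z != y -> z != v ->
    is_angle (x - y) (z - v) alpha -> ~ is_rational (cos alpha ^+ 2).
  move=> Ex Ey Ez Ev xy xz xv zy zv ang [q qE].
  have := angle_form_cantor_set_neq0 i0 i1 i01 (numq q) (denq q) x y z v
    (coprime_num_den q) Ex Ey Ez Ev xy xz xv zy zv.
  rewrite (is_angle_angle_form _ _ _ _ _ _ _ _ ang qE) ?eqxx //.
    by rewrite subr_eq0.
  by rewrite subr_eq0.
exists E; split.
- exact: compact_cantor_set.
- by apply: hausdorff_dim_cantor_set; exact: ltnW.
- move=> [x [y [z [alpha [[Ex Ey Ez] [+ ang rat]]]]]].
  rewrite /= !inE negb_or andbT => /andP[/andP[xy xz] yz].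
  (* In each case the vertex is taken as both the second and the fourth point of [avoid]. *)
  case: ang rat => ang; [apply: avoid ang|apply: avoid ang|apply: avoid ang];
    by rewrite // eq_sym.
- move=> [x [y [z [v [alpha [[Ex Ey Ez Ev] [+ ang]]]]]]].
  rewrite /= !inE !negb_or andbT => /and3P[/and3P[xy xz xv] /andP[yz yv] zv].
  by apply: avoid ang; rewrite // eq_sym.
Qed.
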